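(* Let $s\ge 1$, $k\ge 2$ and $d\ge k(2s+1)+1$ be integers. Let $\mathbf{j}=[1,1,\dots,1]\in\mathbb{R}^d$ and let $$D_{s,k}^{d}=\Big\{\, [1^{s},0^{d-s}]-\tfrac{s-1}{d-2k}\mathbf{j}\,\Big\}\cup\Big\{\,[1^{s+1},0^{d-s-1}]-\tfrac{s}{d-2k}\mathbf{j}\,\Big\}\subset\mathbb{R}^d,$$ where all permutations of the coordinates of $[1^s,0^{d-s}]$ and of $[1^{s+1},0^{d-s-1}]$ are taken (so $|D_{s,k}^d|=\binom{d}{s}+\binom{d}{s+1}$). Define $$P_{s,k}^{d}=\tfrac12\,\mathrm{conv}\big(D_{s,k}^{d}\cup(-D_{s,k}^{d})\big),$$ and let $\Lambda_{s,k}^d$ be the affine lattice generated by the vertex set of $P_{s,k}^d$. Then $P_{s,k}^{d}$ is a centrally symmetric perfect Delaunay polytope for the affine lattice $\Lambda_{s,k}^d$; the origin is its center of symmetry and does not belong to $\Lambda_{s,k}^d$. Moreover, its circumscribing empty ellipsoid can be given by an equation $\varphi_{s,k}^d(\mathbf{x})=R^2$ for some $R>0$, where $$\varphi_{s,k}^{d}(\mathbf{x})=4k\big(d-k(2s+1)\big)|\mathbf{x}|^{2}+\big(d^{2}-(4k+2s+1)d+4k(2s+k)\big)(\mathbf{j}\cdot\mathbf{x})^{2}.$$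
   Context: Notation: $[1^a,0^b]$ denotes the vector with $a$ entries equal to $1$ followed by $b$ entries equal to $0$. The affine lattice generated by a finite set $V\subset\mathbb{R}^d$ is the set of all integer affine combinations $\sum_i c_i v_i$ with $v_i\in V$, $c_i\in\mathbb{Z}$, $\sum_i c_i=1$. Let $L$ be an affine lattice (a translate of a discrete subgroup) spanning an affine space $A$, and let $D\subset A$ be a polytope whose vertices lie in $L$ and with $\dim D=\dim A$. An ellipsoid $\mathcal{E}=\{\mathbf{x}\in A:\ q(\mathbf{x}-\mathbf{c})=R^2\}$ ($q$ a positive definite quadratic form, $\mathbf{c}\in A$, $R>0$) is an empty circumscribing ellipsoid of $D$ if no point of $L$ satisfies $q(\mathbf{x}-\mathbf{c})<R^2$ and $\mathcal{E}\cap L$ is exactly the vertex set of $D$. $D$ is a Delaunay polytope for $L$ if it has an empty circumscribing ellipsoid, and a perfect Delaunay polytope if it has exactly one empty circumscribing ellipsoid. $|\mathbf{x}|$ is the Euclidean norm. *)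

(* Defs.v *)
From mathcomp Require Import all_boot all_order all_fingroup all_algebra.
From mathcomp Require Import all_classical all_reals all_analysis.

Set Implicit Arguments.
Unset Strict Implicit.
Unset Printing Implicit Defensive.

Import Order.TTheory GRing.Theory Num.Theory.
Import numFieldNormedType.Exports.

Local Open Scope classical_set_scope.
Local Open Scope ring_scope.

Section Polytopes.
Variables (R : realType) (d : nat).
Local Notation V := 'rV[R]_d.
Implicit Types (S P L A D E G : set V) (q : V -> R) (c x y : V) (r : R).

Definition affine_hull S : set V :=
  [set x | exists (n : nat) (a : 'I_n -> R) (v : 'I_n -> V),
    [/\ forall i, S (v i), \sum_(i < n) a i = 1
      & x = \sum_(i < n) a i *: v i]].

Definition convex_hull S : set V :=
  [set x | exists (n : nat) (a : 'I_n -> R) (v : 'I_n -> V),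
    [/\ forall i, S (v i), forall i, 0 <= a i, \sum_(i < n) a i = 1
      & x = \sum_(i < n) a i *: v i]].

Definition generated_affine_lattice S : set V :=
  [set x | exists (n : nat) (a : 'I_n -> int) (v : 'I_n -> V),
    [/\ forall i, S (v i), \sum_(i < n) a i = 1
      & x = \sum_(i < n) v i *~ a i]].

Definition subgroup G : Prop :=
  G 0 /\ (forall x y, G x -> G y -> G (x - y)).

Definition affine_lattice L : Prop :=
  exists (t : V) G,
    [/\ subgroup G, G `<=` isolated G & L = [set t + g | g in G]].

Definition has_dim S (n : nat) : Prop :=
  exists (t : V) (U : {vspace V}),
    \dim U = n /\ affine_hull S = [set t + u | u in [set` U]].

Definition polytope P : Prop :=
  exists2 S, finite_set S & P = convex_hull S.

(* Extreme points. *)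
Definition vertices P : set V :=
  [set x | P x /\ forall (y z : V) (a : R), P y -> P z -> 0 < a < 1 ->
    x = a *: y + (1 - a) *: z -> y = x /\ z = x].

Definition symmetric_about c P : Prop :=
  forall x, P x -> P (c *+ 2 - x).

Definition quadratic_form q : Prop :=
  exists Q : 'M[R]_d, forall x, q x = (x *m Q *m x^T) 0 0.

Definition positive_definite q : Prop := forall x, x != 0 -> 0 < q x.

Definition ellipsoid A q c r : set V :=
  [set x | A x /\ q (x - c) = r ^+ 2].

(* q is a form on all of R^d rather than on the direction space of the span of
   L: every positive definite form on a subspace is the restriction of one on
   R^d, so the ellipsoids obtained are the same. *)
Definition empty_circumscribing L D q c r : Prop :=
  let A := affine_hull L in
  [/\ quadratic_form q /\ positive_definite q,
      A c, 0 < r,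
      forall x, L x -> ~ (q (x - c) < r ^+ 2)
    & ellipsoid A q c r `&` L = vertices D].

(* Ellipsoids are compared as sets of points: rescaling q and r does not give
   a new ellipsoid. *)
Definition empty_circumscribing_ellipsoid L D E : Prop :=
  exists q c r,
    empty_circumscribing L D q c r /\ E = ellipsoid (affine_hull L) q c r.

Definition lattice_polytope L D : Prop :=
  [/\ affine_lattice L, polytope D, D `<=` affine_hull L, vertices D `<=` L
    & exists n, has_dim D n /\ has_dim (affine_hull L) n].

Definition Delaunay_polytope L D : Prop :=
  lattice_polytope L D /\ exists E, empty_circumscribing_ellipsoid L D E.

Definition perfect_Delaunay_polytope L D : Prop :=
  Delaunay_polytope L D /\ exists! E, empty_circumscribing_ellipsoid L D E.

Definition dotv (x y : V) : R := \sum_(i < d) x 0 i * y 0 i.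

Definition enorm x : R := Num.sqrt (dotv x x).

Definition allones : V := const_mx 1.

(* The vector [1^m, 0^(d-m)]; its meaning requires m <= d. *)
Definition ones_zeros (m : nat) : V := \row_(i < d) (i < m)%N%:R.

Definition perms_ones_zeros (m : nat) : set V :=
  [set col_perm sigma (ones_zeros m) | sigma in [set: 'S_d]].

Definition Dset (s k : nat) : set V :=
  [set v - ((s%:R - 1) / (d%:R - 2 * k%:R)) *: allones
     | v in perms_ones_zeros s] `|`
  [set v - (s%:R / (d%:R - 2 * k%:R)) *: allones
     | v in perms_ones_zeros s.+1].

Definition Ppoly (s k : nat) : set V :=
  [set 2^-1 *: x
     | x in convex_hull (Dset s k `|` [set - v | v in Dset s k])].

Definition Lambda (s k : nat) : set V :=
  generated_affine_lattice (vertices (Ppoly s k)).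

Definition phi (s k : nat) (x : V) : R :=
  4 * k%:R * (d%:R - k%:R * (2 * s%:R + 1)) * enorm x ^+ 2
  + (d%:R ^+ 2 - (4 * k%:R + 2 * s%:R + 1) * d%:R
     + 4 * k%:R * (2 * s%:R + k%:R)) * dotv allones x ^+ 2.

End Polytopes.

(* Main.v *)
Require Import Defs.
From mathcomp Require Import all_boot all_order all_fingroup all_algebra.
From mathcomp Require Import all_classical all_reals all_analysis.
From mathcomp Require Import zify ring lra.

(** Put m = d - 2k. Every point of 2 Lambda is u - ((sum u - N) / m) j with u
    integral and N odd; the points of D are those with N = 1 and u a 0/1 vector
    of weight s or s + 1. Replacing (u, N) by (u - r j, N - 2kr) does not move
    the point, so up to central symmetry 1 <= N <= k. There phi is an integral
    polynomial in |u|^2, sum u and N whose minimum is reached exactly on D; this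
    gives emptiness, and strict convexity of phi identifies the vertices.

    For uniqueness, central symmetry of the vertex set forces the centre to be
    0. Let S be the matrix of a form constant on D. Exchanging the coordinates
    i and l in a point of D gives linear equations on the difference of the rows
    i and l of S, whose only solution (as k >= 2) is the one where S is a
    combination of the identity and the all-ones matrix. The two levels s and
    s + 1 then leave only the multiples of phi. *)

Set Implicit Arguments.
Unset Strict Implicit.
Unset Printing Implicit Defensive.

Import Order.TTheory GRing.Theory Num.Theory.
Import numFieldNormedType.Exports.

Local Open Scope classical_set_scope.
Local Open Scope ring_scope.

(** * Integer inequalities behind emptiness *)

(* The value of phi at u - ((sg - N) / (d - 2k)) j for an integral u, where
   S = |u|^2, sg = sum u and h = d - k(2s + 1); see phi_lattice_point. *)
Definition intphi (s k h S sg N : int) : int :=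
  4 * k * h * S + 4 * k * (k - 1) * sg ^+ 2
  + (h + (k - 1) * (2 * s + 1)) * ((h + k * (2 * s + 1)) * N ^+ 2 - 4 * k * N * sg).

(* Used with e = h (N - 1) and z = 2 sg - N (2s + 1), nonzero because it is odd:
   the real minimum over sg alone is too small when k is large. *)
Lemma odd_parabola_gap (k e z : int) : 2 < k -> 0 < e -> z != 0 ->
  0 < e * (3 * k - 2) * (k - 1) + k * (((k - 1) * z - e) ^+ 2 - (k - 1) ^+ 2).
Proof.
move=> k2 e0 z0; have [eK|eK] := leP (k - 1) e.
  have sq := sqr_ge0 ((k - 1) * z - e).
  have : (k - 1) * ((3 * k - 2) * (k - 1)) <= e * ((3 * k - 2) * (k - 1)).
    by rewrite ler_wpM2r // mulr_ge0; lia.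
  nia.
(* Here [0 < e / (k - 1) < 1], and since [z = 0] is excluded the nearest integer allowed is
   [z = 1]. *)
have abs_le : (k - 1 - e) ^+ 2 <= ((k - 1) * z - e) ^+ 2.
  rewrite -subr_ge0 subr_sqr.
  have [z1|z1] : 1 <= z \/ z <= - 1 by lia.
    by rewrite mulr_ge0; nia.
  by rewrite mulr_le0; nia.
have -> : e * (3 * k - 2) * (k - 1) + k * (((k - 1) * z - e) ^+ 2 - (k - 1) ^+ 2)
    = e * ((k - 1) * (k - 2) + k * e)
      + k * (((k - 1) * z - e) ^+ 2 - (k - 1 - e) ^+ 2) by ring.
by rewrite ltr_wpDr ?mulr_gt0 ?mulr_ge0 ?subr_ge0 ?addr_gt0 ?mulr_gt0 //; lia.
Qed.

(* N = 2 n + 1. *)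
Lemma intphi_min (s k h S sg n : int) :
    1 <= s -> 2 <= k -> 1 <= h -> sg <= S -> 0 <= n -> 2 * n + 1 <= k ->
  intphi s k h s s 1 <= intphi s k h S sg (2 * n + 1) /\
  (intphi s k h S sg (2 * n + 1) = intphi s k h s s 1 ->
   [/\ n = 0, S = sg & sg = s \/ sg = s + 1]).
Proof.
move=> s1 k2 h1 leS n0 nk.
have hS : 0 <= 4 * k * h * (S - sg) by rewrite !mulr_ge0; lia.
have [->|/eqP nn0] := eqVneq n 0.
  (* At [N = 1] the excess splits into two nonnegative terms; the product of consecutive integers
     vanishes only at the two levels. *)
  have E : intphi s k h S sg (2 * 0 + 1) - intphi s k h s s 1 =
    4 * k * h * (S - sg) + 4 * k * (k - 1) * ((sg - s) * (sg - s - 1)).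
    by rewrite /intphi; ring.
  have pr : 0 <= (sg - s) * (sg - s - 1).
    have [?|?] : sg <= s \/ s + 1 <= sg by lia.
      by rewrite mulr_le0; lia.
    by rewrite mulr_ge0; lia.
  have kpr : 0 <= 4 * k * (k - 1) * ((sg - s) * (sg - s - 1)).
    by rewrite mulr_ge0 // !mulr_ge0 //; lia.
  split; first by rewrite -subr_ge0 E addr_ge0.
  move=> /eqP; rewrite -subr_eq0 E paddr_eq0 // !mulf_eq0.
  by move: h1 k2; clear => h1 k2 /andP[E1 E2]; split; lia.
(* The coefficient of [sg ^+ 2] is [4 * k * (k - 1)], so the factor [k - 1] completes the square in
   [sg] without denominators. *)
suff : 0 < (k - 1) * (intphi s k h S sg (2 * n + 1) - intphi s k h s s 1).
  by rewrite pmulr_rgt0; lia.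
have -> : (k - 1) * (intphi s k h S sg (2 * n + 1) - intphi s k h s s 1) =
  (k - 1) * (4 * k * h * (S - sg)) +
  (h * (2 * n)) * (h + (k - 1) * (2 * s + 1)) * (2 * k - 2 - 2 * n) +
  k * (((k - 1) * (2 * sg - (2 * n + 1) * (2 * s + 1)) - h * (2 * n)) ^+ 2 - (k - 1) ^+ 2).
  by rewrite /intphi; ring.
have e0 : 0 < h * (2 * n) by rewrite mulr_gt0; lia.
move: (h * (2 * n)) e0 => e e0.
have z0 : 2 * sg - (2 * n + 1) * (2 * s + 1) != 0 by lia.
have k3 : 2 < k by lia.
rewrite -addrA ltr_wpDl //; first by rewrite mulr_ge0 //; lia.
(* The factors [3 * k - 2] and [k - 1] are lower bounds coming from [h >= 1], [2 * s + 1 >= 3] and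
   [2 * n <= k - 1]. *)
apply: lt_le_trans (odd_parabola_gap k3 e0 z0) _; rewrite lerD2r.
rewrite -!mulrA ler_wpM2l ?(ltW e0) // ler_pM //; try lia.
apply: (@le_trans _ _ (1 + (k - 1) * 3)); first by lia.
by rewrite lerD ?ler_wpM2l //; lia.
Qed.

(** * Bilinear and quadratic forms given by a matrix *)

Section BilinearForms.
Variables (R : realType) (d : nat).
Implicit Types (Q : 'M[R]_d) (x y z : 'rV[R]_d) (a : R).

Definition bil Q x y : R := (x *m Q *m y^T) 0 0.

Lemma bilDl Q x y z : bil Q (x + y) z = bil Q x z + bil Q y z.
Proof. by rewrite /bil !mulmxDl mxE. Qed.

Lemma bilDr Q x y z : bil Q x (y + z) = bil Q x y + bil Q x z.
Proof. by rewrite /bil raddfD mulmxDr mxE. Qed.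

Lemma bilZl Q a x y : bil Q (a *: x) y = a * bil Q x y.
Proof. by rewrite /bil -!scalemxAl mxE. Qed.

Lemma bilZr Q a x y : bil Q x (a *: y) = a * bil Q x y.
Proof. by rewrite /bil linearZ -scalemxAr mxE. Qed.

Lemma bilNl Q x y : bil Q (- x) y = - bil Q x y.
Proof. by rewrite -scaleN1r bilZl mulN1r. Qed.

Lemma bilNr Q x y : bil Q x (- y) = - bil Q x y.
Proof. by rewrite -scaleN1r bilZr mulN1r. Qed.

Definition bilE := (bilDl, bilDr, bilNl, bilNr, bilZl, bilZr).

Lemma bil_suml Q n (v : 'I_n -> 'rV[R]_d) y :
  bil Q (\sum_i v i) y = \sum_i bil Q (v i) y.
Proof. by rewrite /bil !mulmx_suml summxE. Qed.

Lemma bil_sumr Q n (v : 'I_n -> 'rV[R]_d) x :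
  bil Q x (\sum_i v i) = \sum_i bil Q x (v i).
Proof. by rewrite /bil raddf_sum mulmx_sumr summxE. Qed.

Lemma bil_tr Q x y : bil Q^T x y = bil Q y x.
Proof.
have -> : bil Q y x = (y *m Q *m x^T)^T 0 0 by rewrite [RHS]mxE.
by rewrite /bil !trmx_mul trmxK mulmxA.
Qed.

Lemma bil_addmx Q Q' x y : bil (Q + Q') x y = bil Q x y + bil Q' x y.
Proof. by rewrite /bil mulmxDr mulmxDl mxE. Qed.

Lemma bil_delta Q i y : bil Q (delta_mx 0 i) y = \sum_l Q i l * y 0 l.
Proof.
by rewrite /bil -rowE !mxE; apply: eq_bigr => l _; rewrite !mxE.
Qed.

Lemma quadratic_form0 (q : 'rV[R]_d -> R) : quadratic_form q -> q 0 = 0.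
Proof. by case=> Q qE; rewrite qE mul0mx mul0mx mxE. Qed.

Lemma quadratic_formZ (q : 'rV[R]_d -> R) a x :
  quadratic_form q -> q (a *: x) = a ^+ 2 * q x.
Proof.
by case=> Q qE; rewrite !qE -!/(bil _ _ _) bilZl bilZr; ring.
Qed.

Lemma quadratic_formN (q : 'rV[R]_d -> R) x : quadratic_form q -> q (- x) = q x.
Proof. by move=> hq; rewrite -scaleN1r quadratic_formZ // sqrrN expr1n mul1r. Qed.

(** The last term measures strict convexity when [q] is positive definite; it is what makes points
    of an ellipsoid extreme. *)
Lemma quadratic_form_conv (q : 'rV[R]_d -> R) a x y : quadratic_form q ->
  q (a *: x + (1 - a) *: y) =
  a * q x + (1 - a) * q y - a * (1 - a) * q (x - y).
Proof. by case=> Q qE; rewrite !qE -!/(bil _ _ _) !bilE; ring. Qed.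

(** Jensen's inequality: the weighted variance of the [v i] about their barycentre [x] is
    nonnegative and equals the mean of the [q (v i)] minus [q x]. *)
Lemma quadratic_form_le_hull (q : 'rV[R]_d -> R) (S : set 'rV[R]_d) r x :
    quadratic_form q -> positive_definite q -> (forall v, S v -> q v <= r) ->
  convex_hull S x -> q x <= r.
Proof.
move=> hq pd qS [n [a [v [Sv a0 a1 xE]]]].
have q0 y : 0 <= q y.
  by have [->|/pd/ltW//] := eqVneq y 0; rewrite quadratic_form0.
have : 0 <= \sum_i a i * q (v i - x) by rewrite sumr_ge0 // => i _; rewrite mulr_ge0.
case: hq => Q qE.
have -> : \sum_i a i * q (v i - x) = \sum_i a i * q (v i) - q x.
  transitivity (\sum_i (a i * q (v i) - (a i * bil Q (v i) x + a i * bil Q x (v i))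
                         + a i * q x)).
    by apply: eq_bigr => i _; rewrite !qE -!/(bil _ _ _) !bilE; ring.
  rewrite big_split sumrB big_split /= -mulr_suml a1.
  have -> : \sum_i a i * bil Q (v i) x = q x.
    by under eq_bigr do rewrite -bilZl; rewrite -bil_suml -xE qE.
  have -> : \sum_i a i * bil Q x (v i) = q x.
    by under eq_bigr do rewrite -bilZr; rewrite -bil_sumr -xE qE.
  ring.
rewrite subr_ge0 => /le_trans; apply.
have -> : r = \sum_i a i * r by rewrite -mulr_suml a1 mul1r.
by apply: ler_sum => i _; rewrite ler_wpM2l ?qS.
Qed.

End BilinearForms.

(** * Concatenation of two finite families *)

Section Glue.
Variables (T : Type) (n p : nat) (f : 'I_n -> T) (g : 'I_p -> T).

Definition glue (i : 'I_(n + p)) : T :=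
  match fintype.split i with inl l => f l | inr l => g l end.

Lemma glue_lshift i : glue (lshift p i) = f i.
Proof. by rewrite /glue (unsplitK (inl i)). Qed.

Lemma glue_rshift i : glue (rshift n i) = g i.
Proof. by rewrite /glue (unsplitK (inr i)). Qed.

Lemma glue_ind (P : T -> Prop) :
  (forall i, P (f i)) -> (forall i, P (g i)) -> forall i, P (glue i).
Proof. by move=> Pf Pg i; rewrite /glue; case: fintype.split. Qed.

End Glue.

(** * Convex hulls, affine hulls and integer combinations *)

Section Hulls.
Variables (R : realType) (d : nat).
Implicit Types (S W : set 'rV[R]_d) (x y : 'rV[R]_d) (a : R).

Lemma sub_convex_hull S : S `<=` convex_hull S.
Proof.
move=> x Sx; exists 1, (fun=> 1), (fun=> x).
by split=> //; rewrite ?big_ord1 ?scale1r.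
Qed.

Lemma scale_convex_hull a S :
  [set a *: x | x in convex_hull S] = convex_hull [set a *: x | x in S].
Proof.
apply/seteqP; split=> [_ [_ [n [b [v [Sv b0 b1 ->]]]] <-]|x [n [b [v [Sv b0 b1 ->]]]]].
  exists n, b, (fun i => a *: v i); split=> //; first by move=> i; exists (v i).
  by rewrite scaler_sumr; apply: eq_bigr => i _; rewrite !scalerA mulrC.
have /choice[w /all_and2[Sw wE]] : forall i, exists w, S w /\ a *: w = v i.
  by move=> i; have [w] := Sv i; exists w.
exists (\sum_i b i *: w i); first by exists n, b, w.
by rewrite scaler_sumr; apply: eq_bigr => i _; rewrite -wE !scalerA mulrC.
Qed.

(** Some weight [a i] is positive. If it is below 1, [x] lies strictly between [v i] and the
    renormalised combination of the other points, so extremality gives [v i = x]; otherwise the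
    other weights vanish. *)
Lemma vertices_convex_hull S : vertices (convex_hull S) `<=` S.
Proof.
move=> x [[n [a [v [Sv a0 a1 xE]]]] ext].
have [i ai] : exists i, 0 < a i.
  apply/existsP; apply: contraT => /existsPn np.
  suff : \sum_i a i <= 0 by rewrite a1 ler10.
  by rewrite sumr_le0 // => i _; rewrite leNgt.
have sumE : \sum_(l | l != i) a l = 1 - a i.
  by move: a1; rewrite (bigD1 i) //= => <-; rewrite addrAC subrr add0r.
have [ai1|ai1] := ltP (a i) 1; last first.
  have al l : l != i -> a l = 0.
    move=> li; apply/eqP; rewrite eq_le a0 andbT.
    have := sumE; rewrite (bigD1 l) //= => E.
    have : 0 <= \sum_(j < n | (j != i) && (j != l)) a j by rewrite sumr_ge0.
    by rewrite -subr_le0 in ai1; lra.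
  rewrite xE (bigD1 i) //= big1 => [|l /al ->]; last by rewrite scale0r.
  have -> : a i = 1 by move: sumE; rewrite big1 => [|l /al//]; lra.
  by rewrite scale1r addr0.
have [||||<- //] := ext (v i) (\sum_l (if l == i then 0 else a l / (1 - a i)) *: v l) (a i).
- exact: sub_convex_hull.
- eexists; exists (fun l => if l == i then 0 else a l / (1 - a i)), v; split=> //.
    by move=> l; case: eqP => // _; rewrite divr_ge0 // subr_ge0 ltW.
  rewrite (bigD1 i) //= eqxx add0r -[RHS](@divff _ (1 - a i)); last by rewrite subr_eq0 gt_eqF.
  by rewrite -[X in _ = X / _]sumE mulr_suml; apply: eq_bigr => l /negPf ->.
- by rewrite ai ai1.
- rewrite {1}xE (bigD1 i) //=; congr (_ + _).
  rewrite [in RHS](bigD1 i) //= eqxx scale0r add0r scaler_sumr.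
  apply: eq_bigr => l /negPf ->; rewrite scalerA mulrCA divff ?mulr1 //.
  by rewrite subr_eq0 gt_eqF.
Qed.

Lemma convex_hull_opp S : (forall x, S x -> S (- x)) ->
  forall x, convex_hull S x -> convex_hull S (- x).
Proof.
move=> SN x [n [a [v [Sv a0 a1 ->]]]]; exists n, a, (fun i => - v i).
split=> //; first by move=> i; exact: SN.
by rewrite -sumrN; apply: eq_bigr => i _; rewrite scalerN.
Qed.

(** On the hull [q] is at most [r], and by strict convexity it is below [r] strictly inside any
    segment of the hull, so a point with [q x = r] is extreme. *)
Lemma vertices_sphere_hull (q : 'rV[R]_d -> R) S r :
    quadratic_form q -> positive_definite q -> (forall v, S v -> q v = r) ->
  vertices (convex_hull S) = S.
Proof.
move=> hq pd qS; apply/seteqP; split; first exact: vertices_convex_hull.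
move=> x Sx; split=> [|y z a Py Pz /andP[a0 a1] xE]; first exact: sub_convex_hull.
have le_r w : convex_hull S w -> q w <= r.
  by apply: quadratic_form_le_hull => // v /qS ->.
have [yz|yz] := eqVneq y z.
  by move: xE; rewrite -yz -scalerDl subrKC scale1r => ->.
have q0 : 0 < q (y - z) by rewrite pd // subr_eq0.
have := quadratic_form_conv a y z hq; rewrite -xE qS // => E.
have : 0 < a * (1 - a) * q (y - z) by rewrite !mulr_gt0 ?subr_gt0.
have : a * q y <= a * r by rewrite ler_wpM2l ?le_r // ltW.
have : (1 - a) * q z <= (1 - a) * r by rewrite ler_wpM2l ?le_r // subr_ge0 ltW.
by move: E; clear => E ? ? ?; exfalso; lra.
Qed.

Lemma sub_affine_hull S : S `<=` affine_hull S.
Proof.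
move=> x Sx; exists 1, (fun=> 1), (fun=> x).
by split=> //; rewrite ?big_ord1 ?scale1r.
Qed.

Lemma affine_hullS S W : S `<=` W -> affine_hull S `<=` affine_hull W.
Proof.
move=> SW x [n [a [v [Sv a1 xE]]]]; exists n, a, v; split=> // i; exact: SW.
Qed.

Lemma affine_hull_line S a x y : affine_hull S x -> affine_hull S y ->
  affine_hull S (a *: x + (1 - a) *: y).
Proof.
move=> [n [b [v [Sv b1 ->]]]] [p [c [w [Sw c1 ->]]]].
exists (n + p)%N, (glue (fun i => a * b i) (fun i => (1 - a) * c i)), (glue v w).
split; first exact: glue_ind.
- rewrite big_split_ord /=; under eq_bigr do rewrite glue_lshift.
  under [X in _ + X]eq_bigr do rewrite glue_rshift.
  by rewrite -!mulr_sumr b1 c1 !mulr1 subrKC.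
rewrite big_split_ord /= !scaler_sumr.
by congr (_ + _); apply: eq_bigr => i _;
  rewrite ?glue_lshift ?glue_rshift scalerA.
Qed.

(** The midpoint of [w] and [- w] is 0, so the hull is a linear subspace; a sum is twice a
    midpoint. *)
Lemma affine_hull_symmetric S x y a : S !=set0 -> (forall z, S z -> S (- z)) ->
  affine_hull S x -> affine_hull S y -> affine_hull S (a *: x + y).
Proof.
move=> [w Sw] SN Hx Hy.
have H0 : affine_hull S 0.
  have := affine_hull_line 2^-1 (sub_affine_hull Sw) (sub_affine_hull (SN _ Sw)).
  rewrite scalerN -scalerBl (_ : 2^-1 - (1 - 2^-1) = 0 :> R) ?scale0r //.
  by field.
have HZ b z : affine_hull S z -> affine_hull S (b *: z).
  by move=> Hz; have := affine_hull_line b Hz H0; rewrite scaler0 addr0.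
have := HZ 2 _ (affine_hull_line 2^-1 (HZ a _ Hx) Hy).
have -> : 1 - 2^-1 = 2^-1 :> R by field.
by rewrite -scalerDr scalerA divff ?scale1r ?pnatr_eq0.
Qed.

Lemma affine_hullT_dim S : affine_hull S = setT -> has_dim S d.
Proof.
move=> ST; exists 0, fullv; split; first by rewrite dimvf /dim /= mul1n.
by rewrite ST; apply/seteqP; split=> // x _; exists x; rewrite ?add0r //= memvf.
Qed.

(** Keeping the coefficient sum [c] as a parameter treats the affine lattice ([c = 1]) and its
    direction group ([c = 0]) together. *)
Definition int_combination S (c : int) x : Prop :=
  exists (n : nat) (a : 'I_n -> int) (v : 'I_n -> 'rV[R]_d),
    [/\ forall i, S (v i), \sum_i a i = c & x = \sum_i v i *~ a i].

Lemma int_combinationB S b c x y : int_combination S b x ->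
  int_combination S c y -> int_combination S (b - c) (x - y).
Proof.
move=> [n [a [v [Sv <- ->]]]] [p [e [w [Sw <- ->]]]].
exists (n + p)%N, (glue a (fun i => - e i)), (glue v w).
split; first exact: glue_ind.
- rewrite big_split_ord /=; under eq_bigr do rewrite glue_lshift.
  under [X in _ + X = _]eq_bigr do rewrite glue_rshift.
  by rewrite sumrN.
rewrite big_split_ord /= -sumrN.
by congr (_ + _); apply: eq_bigr => i _;
  rewrite ?glue_lshift ?glue_rshift // mulrNz.
Qed.

Lemma sub_int_combination S x : S x -> int_combination S 1 x.
Proof. by move=> Sx; exists 1, (fun=> 1), (fun=> x); rewrite !big_ord1. Qed.

Lemma generated_affine_latticeP S w :
    S w -> int_combination S 0 `<=` isolated (int_combination S 0) ->
  affine_lattice (generated_affine_lattice S).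
Proof.
move=> Sw iso; exists w, (int_combination S 0); split=> //.
  split; first by exists 0, (fun=> 0), (fun=> 0); rewrite !big_ord0; split=> // -[].
  by move=> x y Hx Hy; have := int_combinationB Hx Hy; rewrite subr0.
apply/seteqP; split=> [x Lx|_ [g Gg <-]].
  exists (x - w); last by rewrite addrC subrK.
  by have := int_combinationB Lx (sub_int_combination Sw); rewrite subrr.
(* Only differences are at hand, so [- g] is obtained as [g - g - g], and [w + g] as [w] minus
   that. *)
have G0 := int_combinationB (int_combinationB Gg Gg) Gg.
have := int_combinationB (sub_int_combination Sw) G0.
by rewrite !subr0 subrr sub0r opprK.
Qed.

Lemma isolated_of_separated (G : set 'rV[R]_d) e : 0 < e ->
  (forall x y, G x -> G y -> (forall i, `|x 0 i - y 0 i| < e) -> x = y) ->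
  G `<=` isolated G.
Proof.
move=> e0 sep x Gx; split; first by rewrite inE.
exists (ball x e); first exact: nbhsx_ballx.
apply/seteqP; split=> [y [[_ xy] Gy] /=|_ -> /=]; last by split=> //; exact: ballxx.
by apply/esym/sep => // i; exact: xy.
Qed.

End Hulls.

(** Closure under differences is enough: with [P 0 0] it yields negation, then addition, then
    integer multiples. *)
Lemma int_combination_ind (R : realType) (d : nat) (S : set 'rV[R]_d)
    (P : int -> 'rV[R]_d -> Prop) :
    P 0 0 -> (forall a b x y, P a x -> P b y -> P (a - b) (x - y)) ->
    (forall x, S x -> P 1 x) ->
  forall c x, int_combination S c x -> P c x.
Proof.
move=> P0 PB PS c x [n [a [v [Sv <- ->]]]].
have PN b y : P b y -> P (- b) (- y) by move=> /(PB _ _ _ _ P0); rewrite !sub0r.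
have PD b e y z : P b y -> P e z -> P (b + e) (y + z).
  by move=> Py /PN Pz; have := PB _ _ _ _ Py Pz; rewrite !opprK.
elim/big_ind2: _ => // [b y e z Py Pz|i _]; first exact: PD.
have Pn (m : nat) : P m (v i *+ m).
  by elim: m => // m IH; rewrite mulrSr -addn1 PoszD; apply: PD => //; exact: PS.
by case: (a i) => m; [exact: Pn | rewrite NegzE mulrNz; exact/PN/Pn].
Qed.

Lemma exists_subset_card (T : finType) (B : {set T}) n :
  (n <= #|B|)%N -> exists2 A : {set T}, A \subset B & #|A| = n.
Proof.
rewrite -bin_gt0 -cards_draws card_gt0 => /set0Pn[A].
by rewrite inE => /andP[AB /eqP An]; exists A.
Qed.

(** * Integral coordinates on the doubled lattice *)

Section Lattice.
Variables (R : realType) (d : nat).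
Implicit Types (A : {set 'I_d}) (u : 'rV[int]_d) (N : int).

Lemma dotvE (x y : 'rV[R]_d) : dotv x y = bil 1%:M x y.
Proof. by rewrite /bil mulmx1 mxE; apply: eq_bigr => i _; rewrite !mxE. Qed.

Lemma dotv1E (x : 'rV[R]_d) : dotv (allones R d) x = \sum_i x 0 i.
Proof. by apply: eq_bigr => i _; rewrite mxE mul1r. Qed.

Lemma dotvv_ge0 (x : 'rV[R]_d) : 0 <= dotv x x.
Proof. by rewrite sumr_ge0 // => i _; rewrite -expr2 sqr_ge0. Qed.

Lemma enorm_sqr (x : 'rV[R]_d) : enorm x ^+ 2 = dotv x x.
Proof. exact/sqr_sqrtr/dotvv_ge0. Qed.

Definition indicator_row A : 'rV[int]_d := \row_i (i \in A)%:R.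

Lemma sum_indicator_row A : \sum_i indicator_row A 0 i = #|A|%:R.
Proof.
rewrite -sum1_card natr_sum [RHS]big_mkcond /=.
by apply: eq_bigr => i _; rewrite mxE; case: (i \in A).
Qed.

Lemma perms_ones_zerosE (m : nat) : (m <= d)%N ->
  @perms_ones_zeros R d m =
  [set map_mx intr (indicator_row A) | A in [set A : {set 'I_d} | #|A| = m]].
Proof.
move=> md.
have card_m : #|[set i : 'I_d | (i < m)%N]%SET| = m.
  rewrite -sum1_card (eq_bigl (fun i : 'I_d => (i < m)%N)) => [|i]; last by rewrite inE.
  by rewrite (big_ord_narrow md) sum1_card card_ord.
apply/seteqP; split=> [_ [p _ <-]|_ [A Am <-]].
  exists (p @^-1: [set i : 'I_d | (i < m)%N]%SET).
    by rewrite /= card_preimset ?card_m //; exact: perm_inj.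
  by apply/rowP => i; rewrite !mxE !inE rmorph_nat.
have count_mktuple (f : 'I_d -> bool) b :
    count_mem b [tuple f i | i < d] = #|[set i | f i == b]%SET|.
  rewrite count_map val_ord_tuple enumT cardE /enum_mem size_filter.
  by apply: eq_count => i; rewrite /= inE.
(* Two boolean tuples with equally many entries of each value are permutations of one another. *)
have /tuple_permP[p /= E] :
    perm_eq [tuple i \in A | i < d] [tuple (i < m)%N | i < d].
  apply/allP => b _ /=; rewrite !count_mktuple.
  have cardC (B : {set 'I_d}) : #|B| = m ->
      #|[set i | (i \in B) == b]%SET| = if b then m else (d - m)%N.
    move=> <-; case: b.
      by congr #|pred_of_set _|; apply/setP => i; rewrite !inE eqb_id.
    rewrite cardsCs card_ord; congr (_ - #|pred_of_set _|)%N.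
    by apply/setP => i; rewrite !inE eqbF_neg negbK.
  rewrite cardC // -(cardC _ card_m); apply/eqP; congr #|pred_of_set _|.
  by apply/setP => i; rewrite !inE.
exists p => //; apply/rowP => i; rewrite !mxE.
have /eq_in_map/(_ i) := E; rewrite mem_enum tnth_mktuple => /(_ isT) ->.
by rewrite rmorph_nat.
Qed.

Variable k : nat.
Let m : R := d%:R - 2 * k%:R.

(** Additive in the pair [(u, N)]. Points of [Dset] have [N = 1] and their opposites [N = - 1], so
    [N] has the parity of the coefficient sum of an integer combination. *)
Definition lattice_point u N : 'rV[R]_d :=
  map_mx intr u - ((\sum_i u 0 i - N)%:~R / (d%:R - 2 * k%:R)) *: allones R d.

Lemma lattice_pointE u N i : lattice_point u N 0 i = (u 0 i)%:~R - (\sum_i u 0 i - N)%:~R / m.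
Proof. by rewrite !mxE mulr1. Qed.

Lemma lattice_point0 : lattice_point 0 0 = 0.
Proof.
apply/rowP => i; rewrite lattice_pointE big1 => [|l _]; rewrite !mxE //.
by rewrite subrr mulr0z mul0r subrr.
Qed.

Lemma lattice_pointB u v N M :
  lattice_point u N - lattice_point v M = lattice_point (u - v) (N - M).
Proof.
apply/rowP => i; rewrite [LHS]mxE [X in _ + X]mxE !lattice_pointE.
have -> : \sum_i (u - v) 0 i = \sum_i u 0 i - \sum_i v 0 i.
  by rewrite -sumrB; apply: eq_bigr => l _; rewrite !mxE.
rewrite !mxE !rmorphB /=; ring.
Qed.

Lemma lattice_pointN u N : - lattice_point u N = lattice_point (- u) (- N).
Proof. by rewrite -[LHS]add0r -lattice_point0 lattice_pointB !sub0r. Qed.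

Lemma sum_const (a : int) : \sum_(i < d) (const_mx a : 'rV[int]_d) 0 i = d%:R * a.
Proof. by under eq_bigr do rewrite mxE; rewrite sumr_const card_ord mulr_natl. Qed.

(** The pair [(const_mx r, 2 * k%:R * r)] represents the origin, because [(d r - 2 k r) / m = r]. *)
Lemma lattice_point_shift u N r : m != 0 ->
  lattice_point (u - const_mx r) (N - 2 * k%:R * r) = lattice_point u N.
Proof.
move=> m0; rewrite -lattice_pointB.
suff -> : lattice_point (const_mx r) (2 * k%:R * r) = 0 by rewrite subr0.
apply/rowP => i; rewrite lattice_pointE sum_const !mxE -mulrBl.
rewrite rmorphM rmorphB rmorphM /= !rmorph_nat.
by rewrite /m in m0 *; field.
Qed.
End Lattice.

Lemma phi_quadratic_form (R : realType) (d s k : nat) : quadratic_form (@phi R d s k).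
Proof.
pose a : R := 4 * k%:R * (d%:R - k%:R * (2 * s%:R + 1)).
pose b : R := d%:R ^+ 2 - (4 * k%:R + 2 * s%:R + 1) * d%:R
     + 4 * k%:R * (2 * s%:R + k%:R).
exists (a%:M + b *: (allones R d)^T *m allones R d) => x.
have -> : (x *m (a%:M + b *: (allones R d)^T *m allones R d) *m x^T) =
  a *: (x *m x^T) + b *: ((x *m (allones R d)^T) *m (allones R d *m x^T)).
  by rewrite mulmxDr mulmxDl mul_mx_scalar -!scalemxAl -!scalemxAr -!scalemxAl !mulmxA.
have dotvx : (allones R d *m x^T) 0 0 = dotv (allones R d) x.
  by rewrite dotvE /bil mulmx1.
have xdotv : (x *m (allones R d)^T) 0 0 = dotv (allones R d) x.
  by rewrite -dotvx !mxE; apply: eq_bigr => i _; rewrite !mxE mulrC.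
rewrite mxE [X in _ = X + _]mxE [X in _ = _ + X]mxE [X in _ = _ + _ * X]mxE big_ord1.
by rewrite dotvx xdotv -expr2 /phi enorm_sqr dotvE /bil mulmx1.
Qed.

(** * Minimum of [phi] over the doubled lattice *)

Section Form.
Variables (R : realType) (d s k : nat).
Implicit Types (u : 'rV[int]_d) (N : int).
Hypotheses (s_gt0 : (0 < s)%N) (k_gt1 : (1 < k)%N) (dsk : (k * (2 * s + 1) < d)%N).

Let m : R := d%:R - 2 * k%:R.
Let h : int := d%:Z - k%:Z * (2 * s%:Z + 1).

Lemma d_sub_2k_gt0 : 0 < m.
Proof. by rewrite subr_gt0 -natrM ltr_nat; nia. Qed.

Lemma d_sub_2k_neq0 : d%:R - 2 * k%:R != 0 :> R.
Proof. exact/lt0r_neq0/d_sub_2k_gt0. Qed.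

Lemma h_gt0 : 0 < h.
Proof. by rewrite /h; lia. Qed.

Lemma dotv_lattice_point u N (t : R) : t = (\sum_i u 0 i - N)%:~R / m ->
  dotv (lattice_point R k u N) (lattice_point R k u N) =
  (\sum_i u 0 i ^+ 2)%:~R - 2 * t * (\sum_i u 0 i)%:~R + d%:R * t ^+ 2.
Proof.
move=> tE; rewrite !rmorph_sum /= mulr_sumr -sumrB.
have -> : d%:R * t ^+ 2 = \sum_(i < d) t ^+ 2 by rewrite sumr_const card_ord mulr_natl.
rewrite -big_split; apply: eq_bigr => i _ /=.
by rewrite lattice_pointE -/m -tE rmorphXn /=; ring.
Qed.

Lemma sum_lattice_point u N :
  \sum_i lattice_point R k u N 0 i = (d%:R * N%:~R - 2 * k%:R * (\sum_i u 0 i)%:~R) / m.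
Proof.
under eq_bigr do rewrite lattice_pointE -/m.
rewrite sumrB -rmorph_sum sumr_const card_ord /= rmorphB /= -[_ *+ d]mulr_natl /m.
by field; exact: d_sub_2k_neq0.
Qed.

(** All powers of [m] cancel, which turns the minimum of [phi] into a question about integers. *)
Lemma phi_lattice_point u N :
  phi s k (lattice_point R k u N) =
  (intphi s k h (\sum_i u 0 i ^+ 2) (\sum_i u 0 i) N)%:~R.
Proof.
rewrite /phi enorm_sqr (dotv_lattice_point erefl) dotv1E sum_lattice_point.
move: (\sum_i u 0 i ^+ 2) (\sum_i u 0 i) => S sg.
rewrite /intphi /h /m -!natz !(rmorphD, rmorphM, rmorphB, rmorphXn, rmorph_nat, rmorph1) /=.
by field; exact: d_sub_2k_neq0.
Qed.

Lemma dotvv_gt0 (x : 'rV[R]_d) : x != 0 -> 0 < dotv x x.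
Proof.
move=> x0; rewrite lt_def dotvv_ge0 andbT; apply: contra x0 => /eqP xx0.
apply/eqP/rowP => i; rewrite mxE; apply/eqP; rewrite -sqrf_eq0 expr2.
have /psumr_eq0P : \sum_i x 0 i * x 0 i = 0 by [].
by move=> ->// l _; rewrite -expr2 sqr_ge0.
Qed.

(** Up to the factor [d], [phi] is a positive multiple of the Cauchy-Schwarz defect of [x] against
    [j] plus a positive multiple of [S ^+ 2]. When [S = 0] the first term is positive, otherwise the
    second. *)
Lemma phi_positive_definite : positive_definite (@phi R d s k).
Proof.
move=> x x0; have xx := dotvv_gt0 x0.
have d0 : 0 < d%:R :> R by rewrite ltr0n; lia.
set S := dotv (allones R d) x.
have CS : 0 <= d%:R * dotv x x - S ^+ 2.
  rewrite -(pmulr_rge0 _ d0).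
  (* Cauchy-Schwarz against [j], written as an explicit sum of squares. *)
  have -> : d%:R * (d%:R * dotv x x - S ^+ 2) = \sum_i (d%:R * x 0 i - S) ^+ 2.
    have -> : \sum_i (d%:R * x 0 i - S) ^+ 2 =
        \sum_i (d%:R ^+ 2 * (x 0 i * x 0 i) - 2 * d%:R * S * x 0 i + S ^+ 2).
      by apply: eq_bigr => i _; ring.
    rewrite big_split sumrB -!mulr_sumr /= sumr_const card_ord -dotv1E -/S -/(dotv x x).
    by rewrite -mulr_natl; ring.
  by rewrite sumr_ge0 // => i _; rewrite sqr_ge0.
have hR : 0 < d%:R - k%:R * (2 * s%:R + 1) :> R.
  by rewrite subr_gt0 -natrM -[1]/(1%:R) -natrD -natrM ltr_nat.
have gR : 0 < d%:R - 2 * s%:R - 1 :> R.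
  by rewrite -addrA -opprD subr_gt0 -natrM -[1]/(1%:R) -natrD ltr_nat; nia.
have k0 : 0 < k%:R :> R by rewrite ltr0n; lia.
have E : d%:R * phi s k x =
    4 * k%:R * (d%:R - k%:R * (2 * s%:R + 1)) * (d%:R * dotv x x - S ^+ 2)
    + m ^+ 2 * (d%:R - 2 * s%:R - 1) * S ^+ 2.
  by rewrite /phi enorm_sqr -/S /m; ring.
rewrite -(pmulr_rgt0 _ d0) E.
have [S0|S0] := eqVneq S 0.
  by rewrite S0 expr0n /= subr0 mulr0 addr0 !mulr_gt0.
apply: ltr_wpDl; first by rewrite mulr_ge0 // !mulr_ge0 // ltW.
have S2 : 0 < S ^+ 2 by rewrite exprn_even_gt0.
have m2 : 0 < m ^+ 2 by rewrite exprn_gt0 // d_sub_2k_gt0.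
exact: mulr_gt0 (mulr_gt0 m2 gR) S2.
Qed.

Definition level (A : {set 'I_d}) := (#|A| == s) || (#|A| == s.+1).

Let phi0 := intphi s k h s s 1.

(** For a 0/1 vector of weight [sg] and [N = 1], [intphi] is a parabola in [sg] symmetric about
    [s + 1/2], so both levels give one value. *)
Lemma phi_Dset (A : {set 'I_d}) :
  level A -> phi s k (lattice_point R k (indicator_row A) 1) = phi0%:~R.
Proof.
have sqE : \sum_i indicator_row A 0 i ^+ 2 = #|A|%:R.
  by rewrite -sum_indicator_row; apply: eq_bigr => i _; rewrite mxE; case: (i \in A).
rewrite /level phi_lattice_point sum_indicator_row sqE /phi0 /intphi (natz #|A|).
move=> /orP[/eqP ->|/eqP ->] //.
by congr (_%:~R); rewrite -(addn1 s) PoszD; ring.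
Qed.

(** An integer is at most its square, with equality only at 0 and 1. Hence [intphi_min] applies, and
    its equality case makes [u] an indicator row. *)
Lemma phi_lattice_point_min_pos u (n : int) : 0 <= n -> 2 * n + 1 <= k%:Z ->
  phi0%:~R <= phi s k (lattice_point R k u (2 * n + 1)) /\
  (phi s k (lattice_point R k u (2 * n + 1)) = phi0%:~R ->
   exists2 A, level A & lattice_point R k u (2 * n + 1) = lattice_point R k (indicator_row A) 1).
Proof.
move=> n0 nk; rewrite phi_lattice_point.
have sq_ge i : u 0 i <= u 0 i ^+ 2 by nia.
have s1 : 1 <= s%:Z by lia.
have k2 : 2 <= k%:Z by lia.
have h1 : 1 <= h by have := h_gt0; lia.
have leS : \sum_i u 0 i <= \sum_i u 0 i ^+ 2 by rewrite ler_sum.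
have [le eq] := intphi_min s1 k2 h1 leS n0 nk.
split; first by rewrite ler_int.
move=> /intr_inj/eq[-> /eqP]; rewrite mulr0 add0r.
rewrite -subr_eq0 => sqE sumE.
pose A := [set i | u 0 i == 1]%SET.
have uA : u = indicator_row A.
  apply/rowP => i; rewrite mxE inE.
  have sum0 : \sum_i (u 0 i ^+ 2 - u 0 i) = 0 by rewrite sumrB; apply/eqP.
  have ge0 l : true -> 0 <= u 0 l ^+ 2 - u 0 l by rewrite subr_ge0.
  have := psumr_eq0P ge0 sum0 (isT : xpredT i).
  by have [->|/eqP u1] := eqVneq (u 0 i) 1; [|nia].
have sgE : \sum_i u 0 i = #|A|%:Z by rewrite uA sum_indicator_row natz.
exists A; last by rewrite uA.
move: sumE; rewrite /level sgE => -[[->]|]; first by rewrite eqxx.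
by rewrite -PoszD addn1 => -[->]; rewrite eqxx orbT.
Qed.

Lemma lattice_point_normalize u (n : int) : exists v (l : int),
  lattice_point R k u (2 * n + 1) = lattice_point R k v (2 * l + 1) /\ - k%:Z <= 2 * l + 1 <= k%:Z.
Proof.
(* Dividing [N + k] instead of [N] by [2 k] centres the remainder, so that [N - 2 k r] lies between
   [- k] and [k]. *)
pose r := ((2 * n + 1 + k%:Z) %/ (2 * k%:Z))%Z.
exists (u - const_mx r), (n - k%:Z * r); split.
  rewrite -(lattice_point_shift u (2 * n + 1) r d_sub_2k_neq0); congr (lattice_point R k _ _).
  by rewrite natz; ring.
have k2 : 0 < 2 * k%:Z by lia.
have := divz_eq (2 * n + 1 + k%:Z) (2 * k%:Z); rewrite -/r.
have := modz_ge0 (2 * n + 1 + k%:Z) (lt0r_neq0 k2).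
have := ltz_pmod (2 * n + 1 + k%:Z) k2.
move: (_ %% _)%Z => z z1 z2 E.
have {E} -> : 2 * (n - k%:Z * r) + 1 = z - k%:Z.
  by apply: subr0_eq; move: E; clear; lia.
lia.
Qed.

Lemma phi_lattice_point_min u (n : int) :
  phi0%:~R <= phi s k (lattice_point R k u (2 * n + 1)) /\
  (phi s k (lattice_point R k u (2 * n + 1)) = phi0%:~R ->
   exists2 A, level A & lattice_point R k u (2 * n + 1) = lattice_point R k (indicator_row A) 1
                     \/ lattice_point R k u (2 * n + 1) = - lattice_point R k (indicator_row A) 1).
Proof.
have [v [l [-> lk]]] := lattice_point_normalize u n.
have [l0|l0] := leP 0 l.
  have [|le eq] := @phi_lattice_point_min_pos v l l0; first by lia.
  by split=> // /eq[A lA ->]; exists A => //; left.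
(* Central symmetry reduces negative [N] to positive: [- (2 * l + 1) = 2 * (- l - 1) + 1]. *)
have [||le eq] := @phi_lattice_point_min_pos (- v) (- l - 1); [lia|lia|].
have E : lattice_point R k (- v) (2 * (- l - 1) + 1) = - lattice_point R k v (2 * l + 1).
  by rewrite lattice_pointN; congr (lattice_point R k _ _); ring.
move: le eq; rewrite E quadratic_formN; last exact: phi_quadratic_form.
by move=> le eq; split=> // /eq[A lA lE]; exists A => //; right; rewrite -lE opprK.
Qed.

End Form.

(** * The polytope, its vertices, its lattice and its empty ellipsoid *)

Section Polytope.
Variables (R : realType) (d s k : nat).
Hypotheses (s_gt0 : (0 < s)%N) (k_gt1 : (1 < k)%N) (dsk : (k * (2 * s + 1) < d)%N).
Implicit Types (A T : {set 'I_d}) (x y : 'rV[R]_d).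

Let m : R := d%:R - 2 * k%:R.
Let h : int := d%:Z - k%:Z * (2 * s%:Z + 1).
Let phi0 := intphi s k h s s 1.

Definition Dpoint A : 'rV[R]_d := lattice_point R k (indicator_row A) 1.

Definition Pvertices : set 'rV[R]_d :=
  [set 2^-1 *: x | x in Dset s k `|` [set - v | v in Dset s k]].

Lemma DsetE : @Dset R d s k = [set Dpoint A | A in [set A | level s A]].
Proof.
have DpointE A c : #|A|%:R - 1 = c :> R ->
    Dpoint A = map_mx intr (indicator_row A) - (c / m) *: allones R d.
  by move=> <-; rewrite /Dpoint /lattice_point sum_indicator_row rmorphB /= rmorph_nat.
rewrite /Dset !perms_ones_zerosE; [|nia..].
apply/seteqP; split=> [x [] [_ [A /= As <-] <-]|_ [A lA <-]].
- by exists A; rewrite /= /level ?As ?eqxx // (DpointE _ (s%:R - 1)) ?As.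
- by exists A; rewrite /= /level ?As ?eqxx ?orbT // (DpointE _ s%:R) ?As // -natr1 addrK.
case/orP: lA => /eqP As; [left|right]; (exists (map_mx intr (indicator_row A)); first by exists A).
  by rewrite (DpointE _ (s%:R - 1)) ?As.
by rewrite (DpointE _ s%:R) ?As // -natr1 addrK.
Qed.

Lemma PverticesP x : Pvertices x <->
  exists2 A, level s A & x = 2^-1 *: Dpoint A \/ x = - (2^-1 *: Dpoint A).
Proof.
rewrite /Pvertices DsetE; split=> [[_ [[A lA <-]|[_ [A lA <-] <-]] <-]|[A lA [->|->]]].
- by exists A => //; left.
- by exists A => //; right; rewrite scalerN.
- by exists (Dpoint A) => //; left; exists A.
by exists (- Dpoint A); rewrite ?scalerN //; right; exists (Dpoint A) => //; exists A.
Qed.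


Lemma level_ex : exists2 A : {set 'I_d}, level s A & #|A| = s.
Proof.
have [|A _ As] := @exists_subset_card _ [set: 'I_d]%SET s.
  by rewrite cardsT card_ord; nia.
by exists A; rewrite // /level As eqxx.
Qed.

Lemma Pvertices_nonempty : Pvertices !=set0.
Proof.
have [A lA As] := level_ex; exists (2^-1 *: Dpoint A).
by apply/PverticesP; exists A => //; left.
Qed.

Lemma Pvertices_opp x : Pvertices x -> Pvertices (- x).
Proof.
move=> /PverticesP[A lA xE]; apply/PverticesP; exists A => //.
by case: xE => ->; [right|left; rewrite opprK].
Qed.

Lemma finite_Pvertices : finite_set Pvertices.
Proof.
apply: finite_image; rewrite finite_setU DsetE.
by split; do ?apply: finite_image; exact: finite_finset.
Qed.

Lemma PpolyE : @Ppoly R d s k = convex_hull Pvertices.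
Proof. by rewrite /Ppoly scale_convex_hull. Qed.

(** The sum is [(d - 2 k s) / m], and [d > k (2 s + 1)]. It serves as a divisor when the affine span
    is computed. *)
Lemma sum_Dpoint_neq0 A : #|A| = s -> \sum_i Dpoint A 0 i != 0.
Proof.
move=> As; rewrite (sum_lattice_point _ s_gt0 k_gt1 dsk) sum_indicator_row rmorph_nat rmorph1 mulr1.
rewrite mulf_neq0 ?invr_eq0 ?(d_sub_2k_neq0 R s_gt0 k_gt1 dsk) // subr_eq0 -!natrM eqr_nat.
by rewrite As; apply/eqP; nia.
Qed.

Lemma Dpoint_neq0 A : #|A| = s -> Dpoint A != 0.
Proof.
move=> /sum_Dpoint_neq0; apply: contra => /eqP ->.
by rewrite big1 // => i _; rewrite mxE.
Qed.

Lemma phi_Pvertices x : Pvertices x -> phi s k x = phi0%:~R / 4.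
Proof.
have E A : level s A -> phi s k (2^-1 *: Dpoint A) = phi0%:~R / 4.
  move=> lA; rewrite quadratic_formZ; last exact: phi_quadratic_form.
  by rewrite phi_Dset // mulrC exprVn -natrX.
move=> /PverticesP[A lA [->|->]]; last rewrite quadratic_formN; try exact: E.
exact: phi_quadratic_form.
Qed.

Lemma phi0_gt0 : 0 < phi0%:~R :> R.
Proof.
have [A lA As] := level_ex; rewrite -(phi_Dset _ s_gt0 k_gt1 dsk lA).
by apply: phi_positive_definite => //; exact: Dpoint_neq0.
Qed.

Lemma vertices_Ppoly : vertices (@Ppoly R d s k) = Pvertices.
Proof.
rewrite PpolyE; apply: vertices_sphere_hull phi_Pvertices; first exact: phi_quadratic_form.
exact: phi_positive_definite.
Qed.

Lemma LambdaE : @Lambda R d s k = int_combination Pvertices 1.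
Proof. by rewrite /Lambda vertices_Ppoly. Qed.

Lemma int_combination_Pvertices c x : int_combination Pvertices c x ->
  exists u n, x = 2^-1 *: lattice_point R k u (2 * n + c).
Proof.
move: c x; apply: int_combination_ind.
- by exists 0, 0; rewrite mulr0 addr0 lattice_point0 scaler0.
- move=> a b x y [u [n ->]] [v [l ->]]; exists (u - v), (n - l).
  by rewrite -scalerBr lattice_pointB; congr (_ *: lattice_point R k _ _); ring.
move=> x /PverticesP[A lA [->|->]]; first by exists (indicator_row A), 0.
(* The opposite point has [N = - 1 = 2 * (- 1) + 1]. *)
by exists (- indicator_row A), (- 1); rewrite -scalerN lattice_pointN;
  congr (_ *: lattice_point R k _ _).
Qed.

(** [x] is half a lattice point with odd [N], hence the factor 4. The inequality gives emptiness,
    the equality case identifies the points on the ellipsoid. *)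
Lemma Lambda_phi x : Lambda s k x ->
  phi0%:~R / 4 <= phi s k x /\ (phi s k x = phi0%:~R / 4 -> Pvertices x).
Proof.
rewrite LambdaE => /int_combination_Pvertices[u [n ->]].
have [le eq] := phi_lattice_point_min R s_gt0 k_gt1 dsk u n.
rewrite quadratic_formZ; last exact: phi_quadratic_form.
rewrite exprVn -natrX [_^-1 * _]mulrC; split; first by rewrite ler_pM2r.
move=> E; have four0 : 4^-1 != 0 :> R by rewrite invr_eq0.
have [A lA lE] := eq (mulIf four0 E); apply/PverticesP.
by exists A => //; rewrite -scalerN; case: lE => ->; [left|right].
Qed.

(** Coordinates of the direction group are integer multiples of [(2 * m)^-1], so one of smaller
    absolute value is 0. This gives discreteness. *)
Lemma Pvertices_separated x y : int_combination Pvertices 0 x -> int_combination Pvertices 0 y ->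
  (forall i, `|x 0 i - y 0 i| < (2 * m)^-1) -> x = y.
Proof.
move=> Gx Gy lt; apply/subr0_eq.
have : forall i, `|(x - y) 0 i| < (2 * m)^-1 by move=> i; rewrite !mxE.
have /int_combination_Pvertices[u [n ->]] := int_combinationB Gx Gy.
move: (2 * n + _) => N {}lt; apply/rowP => i; have := lt i.
have m0 : 0 < m := d_sub_2k_gt0 R s_gt0 k_gt1 dsk.
set z : int := (d%:Z - 2 * k%:Z) * u 0 i - (\sum_i u 0 i - N).
have -> : (2^-1 *: lattice_point R k u N) 0 i = z%:~R / (2 * m).
  rewrite mxE lattice_pointE -/m /z -!natz !(rmorphB, rmorphM, rmorph_nat) /= -/m.
  by field; exact: lt0r_neq0.
rewrite normrM [`|_^-1|]gtr0_norm ?invr_gt0 ?mulr_gt0 //.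
rewrite gtr_pMl ?invr_gt0 ?mulr_gt0 // -intr_norm ltrz1 mxE => z0.
have -> : z = 0 by lia.
by rewrite mulr0z mul0r.
Qed.

Lemma affine_lattice_Lambda : affine_lattice (@Lambda R d s k).
Proof.
have [w Vw] := Pvertices_nonempty.
rewrite LambdaE; apply: (generated_affine_latticeP Vw).
apply: isolated_of_separated Pvertices_separated.
by rewrite invr_gt0 mulr_gt0 //; exact: d_sub_2k_gt0 dsk.
Qed.

Lemma indicator_row_setU1 T i : i \notin T ->
  indicator_row (i |: T) = delta_mx 0 i + indicator_row T.
Proof.
move=> iT; apply/rowP => l; rewrite !mxE !inE /=.
by have [->|_] := eqVneq l i; rewrite ?(negPf iT) /= ?addr0 ?add0r.
Qed.

(** The two sets have the same size, so the multiples of [j] cancel. *)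
Lemma Dpoint_swap T i l : i \notin T -> l \notin T ->
  Dpoint (i |: T) - Dpoint (l |: T) = delta_mx 0 i - delta_mx 0 l.
Proof.
move=> iT lT; rewrite lattice_pointB; apply/rowP => j.
rewrite lattice_pointE [X in _ - X%:~R / _](_ : _ = 0).
  rewrite mulr0z mul0r subr0 !indicator_row_setU1 // !mxE.
  by rewrite !(rmorphB, rmorphD) /= !rmorph_nat; ring.
rewrite (eq_bigr (fun n =>
  indicator_row (i |: T) 0 n - indicator_row (l |: T) 0 n)) => [|n _]; last first.
  by rewrite !mxE.
by rewrite sumrB !sum_indicator_row !cardsU1 iT lT subrr.
Qed.

(** By symmetry the hull is a linear subspace. Swaps put every difference of basis vectors in it,
    and one [Dpoint A] with nonzero coordinate sum then yields the basis vectors themselves. *)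
Lemma affine_hull_Pvertices : affine_hull Pvertices = setT.
Proof.
apply/seteqP; split=> // x _.
have HD a y z := @affine_hull_symmetric R d Pvertices y z a Pvertices_nonempty Pvertices_opp.
have H0 : affine_hull Pvertices 0.
  have [w /sub_affine_hull Hw] := Pvertices_nonempty.
  by have := HD (-1) _ _ Hw Hw; rewrite scaleN1r addNr.
have HZ a y : affine_hull Pvertices y -> affine_hull Pvertices (a *: y).
  by move=> Hy; have := HD a _ _ Hy H0; rewrite addr0.
have HA y z : affine_hull Pvertices y -> affine_hull Pvertices z -> affine_hull Pvertices (y + z).
  by move=> Hy Hz; have := HD 1 _ _ Hy Hz; rewrite scale1r.
have HB y z : affine_hull Pvertices y -> affine_hull Pvertices z -> affine_hull Pvertices (y - z).
  by move=> Hy Hz; have := HD (-1) _ _ Hz Hy; rewrite scaleN1r addrC.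
have Hsum (f : 'I_d -> 'rV[R]_d) :
    (forall i, affine_hull Pvertices (f i)) -> affine_hull Pvertices (\sum_i f i).
  by move=> Hf; elim/big_ind: _.
have HDpoint A : level s A -> affine_hull Pvertices (Dpoint A).
  move=> lA; rewrite -[Dpoint A](scalerKV (a := 2)) ?pnatr_eq0 //.
  by apply/HZ/sub_affine_hull/PverticesP; exists A => //; left.
have Hdelta2 i l : affine_hull Pvertices (delta_mx 0 i - delta_mx 0 l).
  have [|T /fintype.subsetP TB Ts] := @exists_subset_card _ (~: [set i; l])%SET s.-1.
    by rewrite cardsCs finset.setCK card_ord cards2; nia.
  have iT : i \notin T by apply/negP => /TB; rewrite !inE eqxx.
  have lT : l \notin T by apply/negP => /TB; rewrite !inE eqxx orbT.
  by rewrite -(Dpoint_swap iT lT); apply: HB; apply: HDpoint;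
    rewrite /level cardsU1 ?iT ?lT Ts add1n prednK ?eqxx.
have [A lA As] := level_ex.
have Hdelta i : affine_hull Pvertices (delta_mx 0 i).
  have -> : delta_mx 0 i = (\sum_l Dpoint A 0 l)^-1 *:
      (\sum_l Dpoint A 0 l *: (delta_mx 0 i - delta_mx 0 l) + Dpoint A) :> 'rV[R]_d.
    under [X in _ *: (X + _)]eq_bigr do rewrite scalerBr.
    by rewrite sumrB -scaler_suml -row_sum_delta subrK scalerK // sum_Dpoint_neq0.
  by apply/HZ/HA; [apply: Hsum => l; exact: HZ | exact: HDpoint].
by rewrite [x]row_sum_delta; apply: Hsum => i; exact: HZ.
Qed.

Lemma affine_hull_Lambda : affine_hull (@Lambda R d s k) = setT.
Proof.
apply/seteqP; split=> // x; rewrite -affine_hull_Pvertices LambdaE.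
by apply: affine_hullS => y; exact: sub_int_combination.
Qed.

Lemma affine_hull_Ppoly : affine_hull (@Ppoly R d s k) = setT.
Proof.
apply/seteqP; split=> // x; rewrite -affine_hull_Pvertices PpolyE.
by apply: affine_hullS; exact: sub_convex_hull.
Qed.

Lemma lattice_polytope_Ppoly : lattice_polytope (@Lambda R d s k) (@Ppoly R d s k).
Proof.
split; first exact: affine_lattice_Lambda.
- by exists Pvertices; [exact: finite_Pvertices | exact: PpolyE].
- by rewrite affine_hull_Lambda.
- by rewrite vertices_Ppoly LambdaE => x; exact: sub_int_combination.
exists d; rewrite affine_hull_Lambda; split.
  exact/affine_hullT_dim/affine_hull_Ppoly.
by apply: affine_hullT_dim; apply/seteqP; split=> // x _; exact: sub_affine_hull.
Qed.

Definition circumradius : R := Num.sqrt (phi0%:~R / 4).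

Lemma circumradius_gt0 : 0 < circumradius.
Proof. by rewrite sqrtr_gt0 divr_gt0 ?phi0_gt0. Qed.

Lemma circumradius_sqr : circumradius ^+ 2 = phi0%:~R / 4.
Proof. by rewrite sqr_sqrtr // divr_ge0 ?ltW ?phi0_gt0. Qed.

Lemma empty_circumscribing_phi :
  empty_circumscribing (@Lambda R d s k) (@Ppoly R d s k) (@phi R d s k) 0 circumradius.
Proof.
split.
- by split; [exact: phi_quadratic_form | exact: phi_positive_definite].
- by rewrite affine_hull_Lambda.
- exact: circumradius_gt0.
- by move=> x /Lambda_phi[le _]; rewrite subr0 circumradius_sqr ltNge le.
rewrite vertices_Ppoly; apply/seteqP; split=> [x [[_]]|x Vx].
  by rewrite subr0 circumradius_sqr => xE /Lambda_phi[_]; exact.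
split; last by rewrite LambdaE; exact: sub_int_combination.
by rewrite /ellipsoid /= affine_hull_Lambda subr0 circumradius_sqr phi_Pvertices.
Qed.

(** [phi] vanishes at the origin, below its minimum over the lattice. *)
Lemma Lambda_neq0 : ~ @Lambda R d s k 0.
Proof.
move=> /Lambda_phi[+ _]; rewrite quadratic_form0; last exact: phi_quadratic_form.
by rewrite leNgt divr_gt0 ?phi0_gt0.
Qed.

Lemma symmetric_Ppoly : symmetric_about 0 (@Ppoly R d s k).
Proof.
move=> x; rewrite PpolyE mul0rn sub0r; exact: convex_hull_opp Pvertices_opp _.
Qed.

End Polytope.

(** * Rigidity of the forms constant on [Dset] *)

Section Rigidity.
Variables (R : realType) (d s k : nat).
Hypotheses (s_gt0 : (0 < s)%N) (k_gt1 : (1 < k)%N) (dsk : (k * (2 * s + 1) < d)%N).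
Implicit Types (A T : {set 'I_d}) (i l n : 'I_d).
Variables (S : 'M[R]_d) (rho : R).
Hypotheses (S_sym : S^T = S)
  (S_const : forall A, level s A -> bil S (Dpoint R k A) (Dpoint R k A) = rho).

Let m : R := d%:R - 2 * k%:R.

(* S vanishes on (p - p', p + p') when p' is p with coordinates i and l
   exchanged. *)
Lemma swap_equation T i l : i \notin T -> l \notin T -> level s (i |: T) ->
  2 * (\sum_(j in T) (S i j - S l j)) + (S i i - S l i + (S i l - S l l)) =
  2 * #|T|%:R / m * \sum_j (S i j - S l j).
Proof.
move=> iT lT lvl; have lvl' : level s (l |: T).
  by move: lvl; rewrite /level !cardsU1 iT lT.
have bilC x y : bil S x y = bil S y x by rewrite -[in LHS]S_sym bil_tr.
have : bil S (Dpoint R k (i |: T) - Dpoint R k (l |: T))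
           (Dpoint R k (i |: T) + Dpoint R k (l |: T)) = 0.
  have polar x y : bil S x x = bil S y y -> bil S (x - y) (x + y) = 0.
    by move=> E; rewrite !bilE (bilC y) E; ring.
  by apply: polar; rewrite !S_const.
rewrite Dpoint_swap // bilDl bilNl !bil_delta -sumrB.
(* Since [n |: T] has [#|T| + 1] elements and [N = 1], the multiple of [j] subtracted is
   [#|T| / m]. *)
have DpointE j n : n \notin T ->
    Dpoint R k (n |: T) 0 j = (j \in T)%:R + (j == n)%:R - #|T|%:R / m.
  move=> nT; rewrite /Dpoint lattice_pointE sum_indicator_row cardsU1 nT.
  rewrite add1n -natr1 addrK rmorph_nat.
  rewrite indicator_row_setU1 // !mxE eqxx rmorphD /= !rmorph_nat.
  by rewrite [X in X - _]addrC.
under eq_bigr => j _ do rewrite -mulrBl mxE !DpointE //.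
have sum1 n : \sum_j (S i j - S l j) * (j == n)%:R = S i n - S l n.
  rewrite (bigD1 n) //= eqxx mulr1 big1 ?addr0 // => j /negPf ->.
  by rewrite mulr0.
rewrite (eq_bigr (fun j => 2 * ((S i j - S l j) * (j \in T)%:R)
    + (S i j - S l j) * (j == i)%:R + (S i j - S l j) * (j == l)%:R
    - 2 * #|T|%:R / m * (S i j - S l j))) => [|j _]; last by ring.
rewrite [X in X = 0 -> _]sumrB [X in X - _ = 0 -> _]big_split /=.
rewrite [X in X + _ - _ = 0 -> _]big_split /= -!mulr_sumr !sum1.
have -> : \sum_j (S i j - S l j) * (j \in T)%:R = \sum_(j in T) (S i j - S l j).
  rewrite [RHS]big_mkcond; apply: eq_bigr => j _.
  by case: (j \in T); rewrite ?mulr1 ?mulr0.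
by move/subr0_eq <-; rewrite addrA.
Qed.

(** For [T] of size [s - 1] avoiding all four indices, the swap equations of [n1 |: T] and [n2 |: T]
    differ only in the entry at [n1] or [n2]; the sets swapped have size [s + 1]. *)
Lemma row_diff_const i l n1 n2 : n1 \notin [:: i; l] -> n2 \notin [:: i; l] ->
  S i n1 - S l n1 = S i n2 - S l n2.
Proof.
rewrite !inE !negb_or => /andP[n1i n1l] /andP[n2i n2l].
have [->//|n12] := eqVneq n1 n2.
have [|T /fintype.subsetP TB Ts] := @exists_subset_card _ (~: [set i; l; n1; n2])%SET s.-1.
  rewrite cardsCs finset.setCK card_ord.
  have : (#|[set i; l; n1; n2]%SET| <= 4)%N.
    by rewrite -!finset.setUA !cardsU1 cards1; do !case: (_ \notin _).
  nia.
have notT j : j \in [set i; l; n1; n2]%SET -> j \notin T.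
  by move=> jB; apply/negP => /TB; rewrite inE jB.
have iT : i \notin T by rewrite notT // !inE eqxx.
have lT : l \notin T by rewrite notT // !inE eqxx !orbT.
have n1T : n1 \notin T by rewrite notT // !inE eqxx !orbT.
have n2T : n2 \notin T by rewrite notT // !inE eqxx !orbT.
have eqn n : n \notin T -> n != i -> n != l ->
    2 * (S i n - S l n) + 2 * (\sum_(j in T) (S i j - S l j))
      + (S i i - S l i + (S i l - S l l)) =
    2 * s%:R / m * \sum_j (S i j - S l j).
  move=> nT ni nl; have cardnT : #|n |: T| = s by rewrite cardsU1 nT Ts add1n prednK.
  have inT : i \notin n |: T by rewrite !inE negb_or eq_sym ni.
  have lnT : l \notin n |: T by rewrite !inE negb_or eq_sym nl.
  rewrite -[in RHS]cardnT -swap_equation //.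
    by rewrite big_setU1 //= [in RHS]mulrDr.
  by rewrite /level cardsU1 inT cardnT add1n eqxx orbT.
have := eqn _ n1T n1i n1l; rewrite -(eqn _ n2T n2i n2l) => E.
by apply/eqP; rewrite -subr_eq0; apply/eqP; move: E; lra.
Qed.

(** Let [c] be the common off-diagonal difference, [e] the contribution of the columns [i] and [l],
    and [C] the total. Swap equations with [#|T|] equal to [s] and [s - 1] give [c = C / m] and
    [e = 0]. As [C = (d - 2) c + e] and [m = d - 2 k], this leaves [(k - 1) c = 0]; symmetry turns
    [e = 0] into equality of the diagonal entries. *)
Lemma row_diff_eq0 i l n : i != l -> n \notin [:: i; l] ->
  S i n = S l n /\ S i i = S l l.
Proof.
move=> il nil.
have cE j : j \notin [:: i; l] -> S i j - S l j = S i n - S l n.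
  by move=> jil; exact: row_diff_const.
have sumT T : i \notin T -> l \notin T ->
    \sum_(j in T) (S i j - S l j) = #|T|%:R * (S i n - S l n).
  move=> iT lT; rewrite (eq_bigr (fun=> S i n - S l n)) => [|j jT].
    by rewrite sumr_const mulr_natl.
  by apply: cE; rewrite !inE negb_or; apply/andP; split;
    apply: contraTneq jT => ->.
have [|T /fintype.subsetP TB Ts] := @exists_subset_card _ (~: [set i; l])%SET s.
  by rewrite cardsCs finset.setCK card_ord cards2; nia.
have [|T' /fintype.subsetP TB' Ts'] := @exists_subset_card _ (~: [set i; l])%SET s.-1.
  by rewrite cardsCs finset.setCK card_ord cards2; nia.
have iT : i \notin T by apply/negP => /TB; rewrite !inE eqxx.
have lT : l \notin T by apply/negP => /TB; rewrite !inE eqxx orbT.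
have iT' : i \notin T' by apply/negP => /TB'; rewrite !inE eqxx.
have lT' : l \notin T' by apply/negP => /TB'; rewrite !inE eqxx orbT.
have := swap_equation iT lT; rewrite /level cardsU1 iT Ts add1n eqxx orbT => /(_ isT).
have := swap_equation iT' lT'; rewrite /level cardsU1 iT' Ts' add1n prednK // eqxx => /(_ isT).
rewrite !sumT // Ts Ts'.
have CE : \sum_j (S i j - S l j) =
    (d%:R - 2) * (S i n - S l n) + (S i i - S l i + (S i l - S l l)).
  rewrite (bigD1 i) //= (bigD1 l) /=; last by rewrite eq_sym.
  rewrite (eq_bigl (fun j => j \in ~: [set i; l]%SET)) => [|j]; last first.
    by rewrite !inE negb_or.
  rewrite sumT ?inE ?eqxx ?orbT // cardsCs finset.setCK card_ord cards2 il natrB; last by nia.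
  by rewrite /=; ring.
have -> : s.-1%:R = s%:R - 1 :> R by rewrite -[in RHS](prednK s_gt0) -natr1 addrK.
have m0 : m != 0 := d_sub_2k_neq0 R s_gt0 k_gt1 dsk.
have k1 : k%:R - 1 != 0 :> R by rewrite subr_eq0 (eqr_nat _ k 1); lia.
have sumE : (S i i - S l i) + (S i l - S l l) = 0 -> S i i = S l l.
  by rewrite -[in S l i]S_sym mxE addrA subrK => /subr0_eq.
have diffE := subr0_eq (x := S i n) (y := S l n).
move: (\sum_j _) (S i n - S l n) (S i i - S l i + (S i l - S l l)) CE sumE diffE.
move=> C c e CE e0E c0E E1 E2.
have cC : c = C / m by move: E1 E2; lra.
have e0 : e = 0 by move: E1; rewrite cC; lra.
have c0 : (k%:R - 1) * c = 0.
  have : m * c = C by rewrite cC mulrC divfK.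
  by rewrite CE e0 /m; lra.
by move/eqP: c0; rewrite mulf_eq0 (negPf k1) => /eqP c0; split; [exact: c0E | exact: e0E].
Qed.

(** By [row_diff_eq0] an off-diagonal entry does not depend on its row, hence by symmetry not on its
    column, and the diagonal is constant. *)
Lemma scalar_plus_allones : exists b c : R, forall i l, S i l = b * (i == l)%:R + c.
Proof.
have d1 : (1 < d)%N by nia.
pose i0 := Ordinal (ltnW d1); pose i1 := Ordinal d1.
have SC i l : S i l = S l i by rewrite -[in LHS]S_sym mxE.
have step i i' n : i != n -> i' != n -> S i n = S i' n.
  move=> ni ni'; have [->//|ii'] := eqVneq i i'.
  by have [] := row_diff_eq0 ii' (n := n);
    rewrite ?inE // negb_or ![n == _]eq_sym ni ni'.
have diag i : S i i = S i0 i0.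
  have [->//|ii'] := eqVneq i i0.
  have i01 : i0 != i1 by [].
  have [n /andP[ni ni0]] : exists n, (n != i) && (n != i0).
    have : (0 < #|~: [set i; i0]%SET|)%N by rewrite cardsCs finset.setCK card_ord cards2; nia.
    by move=> /card_gt0P[n]; rewrite !inE negb_or; exists n.
  by have [] := row_diff_eq0 ii' (n := n);
    rewrite ?inE // negb_or ni ni0.
have off i l : i != l -> S i l = S i0 i1.
  (* The entry is carried to position [(i0, i1)] by row changes and transpositions; column [i0] is
     apart, since row [i0] would meet the diagonal there. *)
  move=> il; have [l0|l0] := eqVneq l i0.
    by rewrite l0 in il *; rewrite (step i i1 i0) // SC.
  rewrite (step i i0 l) // 1?eq_sym // SC.
  have [->|l1] := eqVneq l i1; first by rewrite SC.
  by rewrite (step l i1 i0) // SC.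
exists (S i0 i0 - S i0 i1), (S i0 i1) => i l.
by have [->|il] := eqVneq i l; [rewrite diag mulr1 subrK | rewrite off // mulr0 add0r].
Qed.

(** The candidates form a two-parameter family, and equal values at the levels [s] and [s + 1]
    impose one linear relation on [(b, c)]. It is nontrivial because [j] has different squared
    products with the two levels, and [phi] satisfies it with [p != 0]. *)
Lemma bil_proportional : exists b : R, forall x, bil S x x = b * phi s k x.
Proof.
have [b [c SE]] := scalar_plus_allones.
have bilSE x : bil S x x = b * dotv x x + c * (dotv (allones R d) x) ^+ 2.
  rewrite {1}[x]row_sum_delta bil_suml.
  transitivity (\sum_i (b * (x 0 i * x 0 i) + c * dotv (allones R d) x * x 0 i)).
    apply: eq_bigr => i _; rewrite bilZl bil_delta.
    have -> : \sum_l S i l * x 0 l = b * x 0 i + c * dotv (allones R d) x.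
      rewrite dotv1E mulr_sumr.
      transitivity (\sum_l (b * ((i == l)%:R * x 0 l) + c * x 0 l)).
        by apply: eq_bigr => l _; rewrite SE; ring.
      rewrite big_split /= -mulr_sumr (bigD1 i) //= eqxx mul1r big1 ?addr0 // => l.
      by rewrite eq_sym => /negPf ->; rewrite mul0r.
    by ring.
  by rewrite big_split /= -!mulr_sumr -dotv1E expr2 mulrA.
pose p : R := 4 * k%:R * (d%:R - k%:R * (2 * s%:R + 1)).
pose q : R := d%:R ^+ 2 - (4 * k%:R + 2 * s%:R + 1) * d%:R + 4 * k%:R * (2 * s%:R + k%:R).
have phiE x : phi s k x = p * dotv x x + q * (dotv (allones R d) x) ^+ 2.
  by rewrite /phi enorm_sqr.
have hR : 0 < d%:R - k%:R * (2 * s%:R + 1) :> R.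
  by rewrite subr_gt0 -natrM -[1]/(1%:R) -natrD -natrM ltr_nat.
have k0 : 0 < k%:R :> R by rewrite ltr0n; lia.
have p0 : p != 0 by rewrite /p lt0r_neq0 // !mulr_gt0.
have [A _ As] : exists2 A : {set 'I_d}, A \subset [set: 'I_d]%SET & #|A| = s.
  by apply: exists_subset_card; rewrite cardsT card_ord; nia.
have [B _ Bs] : exists2 B : {set 'I_d}, B \subset [set: 'I_d]%SET & #|B| = s.+1.
  by apply: exists_subset_card; rewrite cardsT card_ord; nia.
have lA : level s A by rewrite /level As eqxx.
have lB : level s B by rewrite /level Bs eqxx orbT.
have := S_const lA; rewrite -(S_const lB) !bilSE.
have := phi_Dset R s_gt0 k_gt1 dsk lA.
rewrite -(phi_Dset R s_gt0 k_gt1 dsk lB) !phiE -!/(Dpoint _ _ _).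
have m0 : m != 0 := d_sub_2k_neq0 R s_gt0 k_gt1 dsk.
have JE T : dotv (allones R d) (Dpoint R k T) = (d%:R - 2 * k%:R * #|T|%:R) / m.
  rewrite dotv1E (sum_lattice_point _ s_gt0 k_gt1 dsk) sum_indicator_row.
  by rewrite rmorph_nat rmorph1 mulr1.
have GE : dotv (allones R d) (Dpoint R k A) ^+ 2 - dotv (allones R d) (Dpoint R k B) ^+ 2 =
    4 * k%:R * (d%:R - k%:R * (2 * s%:R + 1)) / m ^+ 2.
  by rewrite !JE As Bs -natr1 /m; field.
have G0 : dotv (allones R d) (Dpoint R k A) ^+ 2 - dotv (allones R d) (Dpoint R k B) ^+ 2 != 0.
  by rewrite GE mulf_neq0 // invr_eq0 sqrf_eq0.
move: (dotv (Dpoint R k A) _) (dotv (Dpoint R k B) _) G0 => u v.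
move: (dotv _ (Dpoint R k A) ^+ 2) (dotv _ (Dpoint R k B) ^+ 2) => w z wz E1 E2.
exists (b / p) => x; rewrite bilSE phiE.
have -> : c = b / p * q; last by field.
(* Eliminating [u - v] between the relation for [S] and the one for [phi] compares [c] with
   [b / p * q]. *)
apply: (mulIf (mulf_neq0 p0 wz)) => /=; apply: subr0_eq.
have -> : c * (p * (w - z)) - b / p * q * (p * (w - z)) =
  p * ((b * u + c * w) - (b * v + c * z)) - b * ((p * u + q * w) - (p * v + q * z)).
  by field.
by rewrite E1 E2; ring.
Qed.

End Rigidity.

(** * Uniqueness of the circumscribing ellipsoid *)

Section Perfection.
Variables (R : realType) (d s k : nat).
Hypotheses (s_gt0 : (0 < s)%N) (k_gt1 : (1 < k)%N) (dsk : (k * (2 * s + 1) < d)%N).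
Implicit Types (A T : {set 'I_d}).

(** Comparing the vertices [x] and [- x] shows that [c] is orthogonal to each vertex for the
    symmetrised form. As [c] is itself a combination of vertices, [q c = 0], so [c = 0]; rigidity
    then applies to [q]. *)
Lemma circumscribing_form (q : 'rV[R]_d -> R) c r :
    quadratic_form q -> positive_definite q ->
    (forall x, Pvertices s k x -> q (x - c) = r ^+ 2) ->
  c = 0 /\ exists b : R, forall x, q x = b * phi s k x.
Proof.
move=> hq pd sphere.
have [Q qE] := hq.
have qbil x : q x = bil Q x x by rewrite qE.
have polar x : Pvertices s k x -> bil Q x c + bil Q c x = 0.
  move=> Vx; have := sphere _ (Pvertices_opp s_gt0 k_gt1 dsk Vx).
  rewrite -(sphere _ Vx) !qbil !bilE.
  lra.
have c0 : c = 0.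
  apply/eqP; apply: contraT => /pd; rewrite qbil.
  have : affine_hull (@Pvertices R d s k) c by rewrite affine_hull_Pvertices.
  case=> n [a [v [Vv _ cE]]].
  have : bil Q c c + bil Q c c = \sum_i a i * (bil Q (v i) c + bil Q c (v i)).
    under eq_bigr do rewrite mulrDr -bilZl -bilZr.
    by rewrite big_split -bil_suml -bil_sumr -cE.
  rewrite big1 => [|i _]; last by rewrite polar ?mulr0.
  by rewrite -mulr2n => /eqP; rewrite mulrn_eq0 /= => /eqP ->; rewrite ltxx.
split=> //.
(* The matrix of a quadratic form need not be symmetric; [Q + Q^T] is, and represents [2 q]. *)
have S_sym : (Q + Q^T)^T = Q + Q^T by rewrite raddfD /= trmxK addrC.
have bilS x : bil (Q + Q^T) x x = 2 * q x.
  by rewrite bil_addmx bil_tr -qbil; ring.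
(* The 8 is 2 from the symmetrisation times 4 from [Dpoint] being twice a vertex. *)
have S_const A : level s A -> bil (Q + Q^T) (Dpoint R k A) (Dpoint R k A) = 8 * r ^+ 2.
  move=> lA; rewrite bilS -(sphere (2^-1 *: Dpoint R k A)); last first.
    by apply/(PverticesP s_gt0 k_gt1 dsk); exists A => //; left.
  by rewrite c0 subr0 quadratic_formZ //; field.
have [b bE] := bil_proportional s_gt0 k_gt1 dsk S_sym S_const.
by exists (b / 2) => x; rewrite mulrAC -bE bilS; field.
Qed.

Lemma perfect_Ppoly : perfect_Delaunay_polytope (@Lambda R d s k) (@Ppoly R d s k).
Proof.
have phiD := empty_circumscribing_phi R s_gt0 k_gt1 dsk.
pose E0 : set 'rV[R]_d := ellipsoid (affine_hull (Lambda s k)) (phi s k) 0 (circumradius R d s k).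
have E0P : empty_circumscribing_ellipsoid (Lambda s k) (Ppoly s k) E0.
  by exists (phi s k), 0, (circumradius R d s k).
split; first by split; [exact: lattice_polytope_Ppoly | exists E0].
exists E0; split=> // _ [q [c [r [[[hq pd] _ r0 _ sphere] ->]]]].
have Vq x : Pvertices s k x -> q (x - c) = r ^+ 2.
  by rewrite -vertices_Ppoly // -sphere => -[[]].
have [-> [b qE]] := circumscribing_form hq pd Vq.
have [w Vw] := Pvertices_nonempty R s_gt0 k_gt1 dsk.
(* One vertex [w] on both ellipsoids fixes the ratio of the squared radii; with [b != 0] the two
   equations then define the same set. *)
have rE : r ^+ 2 = b * circumradius R d s k ^+ 2.
  rewrite -(Vq _ Vw) circumradius_sqr // -(phi_Pvertices s_gt0 k_gt1 dsk Vw) -qE.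
  by have [-> _] := circumscribing_form hq pd Vq; rewrite subr0.
have b0 : b != 0.
  by apply: contraTneq (exprn_gt0 2 r0) => b0; rewrite rE b0 mul0r ltxx.
apply/seteqP; split=> x [Ax]; rewrite !subr0 => xE; split=> //; rewrite subr0.
  by rewrite qE xE rE.
by apply: (mulfI b0); rewrite -qE xE rE.
Qed.

End Perfection.

Theorem theorem4 (R : realType) (s k d : nat)
    (hs : (1 <= s)%N) (hk : (2 <= k)%N) (hd : (k * (2 * s + 1) + 1 <= d)%N) :
  [/\ perfect_Delaunay_polytope (@Lambda R d s k) (@Ppoly R d s k),
      symmetric_about 0 (@Ppoly R d s k),
      ~ @Lambda R d s k 0
    & exists r : R, 0 < r /\
        empty_circumscribing (@Lambda R d s k) (@Ppoly R d s k)
          (@phi R d s k) 0 r].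
Proof.
rewrite addn1 in hd; split.
- exact: perfect_Ppoly.
- exact: symmetric_Ppoly.
- exact: Lambda_neq0.
exists (circumradius R d s k); split; first exact: circumradius_gt0.
exact: empty_circumscribing_phi.
Qed.
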